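(* Let $n\ge 3$ and $2\le k\le 2n$ be integers. Then $$\mathrm{wdim}_{k}(K_n\,\square\,K_n)=\begin{cases}\left\lceil \frac{4n}{3}\right\rceil, & \text{if } k=2,\\[0.2cm] n\left\lceil\frac{k}{2}\right\rceil, & \text{if } k=3 \text{ or } k\ge 4 \text{ is even},\\[0.2cm] n\left\lceil\frac{k}{2}\right\rceil-1, & \text{otherwise (i.e. if } k\ge 5 \text{ is odd)}.\end{cases}$$
   Context: $K_n$ is the complete graph on $n$ vertices. $G\,\square\,H$ denotes the Cartesian product of graphs: its vertex set is $V(G)\times V(H)$, and $(g,h)$, $(g',h')$ are adjacent iff either $g=g'$ and $hh'\in E(H)$, or $gg'\in E(G)$ and $h=h'$. For a connected finite simple graph $G$, $d_G(a,b)$ is the number of edges on a shortest $a,b$-path. For vertices $x,y,z$ put $\Delta_z(x,y)=|d_G(x,z)-d_G(y,z)|$. For an integer $k\ge 1$, a set $S\subseteq V(G)$ is a weak $k$-resolving set of $G$ if $\sum_{w\in S}\Delta_w(x,y)\ge k$ for every two distinct vertices $x,y\in V(G)$. The weak $k$-metric dimension $\mathrm{wdim}_k(G)$ is the minimum cardinality of a weak $k$-resolving set of $G$ (when one exists). *)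

(* Defs.v *)
From mathcomp Require Import all_boot ssrint.

Set Implicit Arguments.
Unset Strict Implicit.
Unset Printing Implicit Defensive.

Local Open Scope nat_scope.

Record sgraph := SGraph {
  vertex :> finType;
  adj : rel vertex;
  adj_sym : symmetric adj;
  adj_irrefl : irreflexive adj
}.

Section Complete.
Variable n : nat.

Definition complete_adj : rel 'I_n := [rel i j | i != j].

Lemma complete_sym : symmetric complete_adj.
Proof. by move=> i j; rewrite /complete_adj /= eq_sym. Qed.

Lemma complete_irrefl : irreflexive complete_adj.
Proof. by move=> i; rewrite /complete_adj /= eqxx. Qed.

Definition complete_graph : sgraph := SGraph complete_sym complete_irrefl.
End Complete.

Section CartesianProduct.
Variables G H : sgraph.

Definition cart_adj : rel (G * H) :=
  [rel u v | (u.1 == v.1) && adj u.2 v.2 || adj u.1 v.1 && (u.2 == v.2)].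

Lemma cart_sym : symmetric cart_adj.
Proof.
move=> u v; rewrite /cart_adj /= (eq_sym u.1) (eq_sym u.2).
by rewrite (adj_sym u.1) (adj_sym u.2).
Qed.

Lemma cart_irrefl : irreflexive cart_adj.
Proof. by move=> u; rewrite /cart_adj /= !adj_irrefl andbF. Qed.

Definition cart_graph : sgraph := SGraph cart_sym cart_irrefl.
End CartesianProduct.

Section WeakDimension.
Variable G : sgraph.

(* A path with d edges from x to y is x :: p with p of length d. *)
Definition has_path (x y : G) (d : nat) : bool :=
  [exists p : d.-tuple G,
     [&& path (@adj G) x p, last x p == y & uniq (x :: p)]].

(* Least d with a path of d edges; a path has fewer than #|G| edges, so the
   search is exhaustive.  The junk value #|G| only occurs when x and y are not
   connected. *)
Definition gdist (x y : G) : nat := find (has_path x y) (iota 0 #|G|).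

(* The subtraction takes place in int, so it is not truncated. *)
Definition Delta (z x y : G) : nat :=
  `|gdist x z - gdist y z|%N.

Definition weak_resolving (k : nat) (S : {set G}) : Prop :=
  forall x y : G, x != y -> k <= \sum_(w in S) Delta w x y.

(* wdim_k(G) exists and equals d. *)
Definition is_wdim (k d : nat) : Prop :=
  (exists2 S : {set G}, weak_resolving k S & #|S| = d) /\
  (forall S : {set G}, weak_resolving k S -> d <= #|S|).
End WeakDimension.

Definition ceil_div (m d : nat) : nat := (m + d.-1) %/ d.

Lemma ceil_divP (m d q : nat) : 0 < d -> (ceil_div m d <= q) = (m <= q * d).
Proof.
case: d => // d _; rewrite /ceil_div /= -ltnS ltn_divLR // mulSn.
by rewrite addnC addSn ltnS leq_add2l.
Qed.

(* Main.v *)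
(** Write [row a] and [col b] for the number of vertices of [S] in a row or
    column of the [n] by [n] grid.  Distances are 0, 1 or 2, so [S] is weakly
    [k]-resolving iff any two rows, and any two columns, together contain at
    least [k] vertices of [S], and for the vertices [(a, b)], [(c, d)] in
    general position
      [row a + row c + col b + col d >= k + 2 [(a, d) \in S] + 2 [(c, b) \in S]].
    At most one row is smaller than [k / 2], which gives the lower bound for
    [k >= 4]; it is attained by an [m]-regular set with [m = ceil (k / 2)], from
    which one vertex is removed when [k] is odd.  For [k = 3] a set of size
    [2n - 1] would have a row and a column of size 1 and all others of size 2,
    which contradicts the third condition.  For [k = 2] there are at least
    [2n - #|S|] rows and [2n - #|S|] columns of size 1, and their vertices are
    essentially distinct, so that [3 #|S| >= 4n]; blocks of 3 rows and columns
    with 4 vertices reach the bound. *)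

Require Import Defs.
From mathcomp Require Import all_boot.
From mathcomp Require Import ssralg zmodp zify.

Set Implicit Arguments.
Unset Strict Implicit.
Unset Printing Implicit Defensive.

Local Open Scope nat_scope.

(** * Fiber sizes of a map on a finite set *)

(** A sum of indicators over [S], so that it merges termwise with sums of [Delta] over [S]. *)
Definition fiber (T I : finType) (p : T -> I) (S : {set T}) (a : I) : nat :=
  \sum_(w in S) (p w == a).

Lemma sum_fiber_weighted (T I : finType) (p : T -> I) (S : {set T})
    (g : I -> nat) :
  \sum_(w in S) g (p w) = \sum_a fiber p S a * g a.
Proof.
under [RHS]eq_bigr do rewrite big_distrl.
rewrite exchange_big; apply: eq_bigr => w _.
rewrite (bigD1 (p w)) //= eqxx mul1n big1 ?addn0 // => a.
by rewrite eq_sym => /negPf ->.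
Qed.

Lemma sum_fiber (T I : finType) (p : T -> I) (S : {set T}) :
  \sum_a fiber p S a = #|S|.
Proof.
rewrite -sum1_card (sum_fiber_weighted p S (fun=> 1)).
by apply: eq_bigr => a _; rewrite muln1.
Qed.

Lemma fiber_gt0P (T I : finType) (p : T -> I) (S : {set T}) (a : I) :
  reflect (exists2 w, w \in S & p w = a) (0 < fiber p S a).
Proof.
apply: (iffP idP) => [|[w wS <-]]; last first.
  by rewrite /fiber (bigD1 w) //= eqxx.
rewrite lt0n; case: (boolP [exists w, (w \in S) && (p w == a)]).
  by case/existsP=> w /andP[wS /eqP pw] _; exists w.
move/existsPn=> H; rewrite /fiber big1 // => w wS.
by have:= H w; rewrite wS /=; case: (p w == a).
Qed.

Lemma fiber_gt1 (T I : finType) (p : T -> I) (S : {set T}) (u v : T) :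
  u \in S -> v \in S -> u != v -> p u = p v -> 1 < fiber p S (p u).
Proof.
move=> uS vS uv puv; rewrite /fiber (bigD1 u) //= (bigD1 v) /=; last first.
  by rewrite vS eq_sym.
by rewrite -puv eqxx.
Qed.

Lemma fiber_card (T I : finType) (p : T -> I) (S : {set T}) (a : I) :
  fiber p S a = #|[set w in S | p w == a]|.
Proof.
rewrite /fiber -sum1_card [RHS](eq_bigl (fun w => (w \in S) && (p w == a))).
  by rewrite big_mkcondr; apply: eq_bigr => w _; case: (p w == a).
by move=> w; rewrite inE.
Qed.

Lemma fiber_setD1 (T I : finType) (p : T -> I) (S : {set T}) (u : T) (a : I) :
  fiber p S a <= fiber p (S :\ u) a + (p u == a).
Proof.
rewrite !fiber_card; case: eqP => [pu|/eqP pu].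
  rewrite (cardsD1 u) addnC leq_add ?leq_b1 // subset_leq_card //.
  by apply/subsetP=> w; rewrite !inE -andbA.
rewrite addn0 subset_leq_card //; apply/subsetP=> w; rewrite !inE.
case/andP=> -> /eqP pw; rewrite pw eqxx !andbT.
by apply: contraNneq pu => <-; rewrite pw.
Qed.

(** * Sums under pairwise lower bounds *)

Lemma sum_pred1 (I : finType) (a : I) : \sum_i (i == a) = 1.
Proof.
by rewrite (bigD1 a) //= eqxx big1 // => i /negPf ->.
Qed.

Lemma sum_ge_but_one (I : finType) (f : I -> nat) (a : I) (q : nat) :
  (forall c, c != a -> q <= f c) -> f a + #|I|.-1 * q <= \sum_i f i.
Proof.
move=> H; rewrite (bigD1 a) //= leq_add2l -(cardC1 a) -sum_nat_const.
by apply: leq_sum => c; apply: H.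
Qed.

(** If [f a] falls short of [uphalf k] by [j > 0], every other value exceeds it by at least
    [j - odd k]. With at least one other index, the total loss is at most [odd k]. *)
Lemma sum_pair_ge (I : finType) (f : I -> nat) (k : nat) :
  1 < #|I| -> (forall a c, a != c -> k <= f a + f c) ->
  #|I| * uphalf k <= \sum_i f i + odd k.
Proof.
move=> cI H.
have [/forallP all_ge|/forallPn[a]] := boolP [forall a, uphalf k <= f a].
  apply: leq_trans (leq_addr _ _); rewrite -sum_nat_const.
  exact: leq_sum.
rewrite -ltnNge => fa.
have /sum_ge_but_one : forall c, c != a -> k - f a <= f c.
  by move=> c ca; rewrite leq_subLR H // eq_sym.
move: fa cI; rewrite uphalf_half; move: (odd_double_half k).
case: #|I| => [|[|N]] //=; nia.
Qed.

Lemma sum_pair3_extremal (I : finType) (f : I -> nat) :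
  2 < #|I| -> (forall a c, a != c -> 3 <= f a + f c) ->
  \sum_i f i < 2 * #|I| ->
  exists2 a, f a <= 1 & forall c, c != a -> f c <= 2.
Proof.
move=> cI H small.
have [/forallP all_ge|/forallPn[a]] := boolP [forall a, 2 <= f a].
  have : \sum_(i : I) 2 <= \sum_i f i by apply: leq_sum.
  by rewrite sum_nat_const mulnC leqNgt small.
rewrite -ltnNge ltnS => fa; exists a => // c ca.
have others e : e != a -> 3 - f a <= f e.
  by move=> ea; rewrite leq_subLR H // eq_sym.
(* [f a = 0] would make all other values at least 3, and [3 (N - 1) >= 2 N] for [N >= 3]. *)
have fa1 : f a = 1.
  have := sum_ge_but_one others; clear others; move: small cI.
  by move: #|I| => N; case: (f a) fa => [|[|]] //= _; lia.
rewrite leqNgt; apply/negP => fc.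
have : \sum_i (2 + (i == c)) <= \sum_i (f i + (i == a)).
  apply: leq_sum => i _; case: (eqVneq i a) => [->|ia].
    by rewrite fa1 eq_sym (negPf ca).
  case: (eqVneq i c) => [->|_]; first lia.
  by have := others _ ia; lia.
rewrite !big_split /= sum_nat_const !sum_pred1.
by move: small; move: #|I| => N; lia.
Qed.

(** * Distances in the rook graph *)

Definition rook (n : nat) : sgraph :=
  cart_graph (complete_graph n) (complete_graph n).

Lemma gdist_eq (G : sgraph) (x y : G) (d : nat) :
  d < #|G| -> has_path x y d -> (forall e, e < d -> ~~ has_path x y e) ->
  gdist x y = d.
Proof.
move=> dG pd minp; rewrite /gdist.
have hs : has (has_path x y) (iota 0 #|G|).
  by apply/hasP; exists d; rewrite ?mem_iota.
apply/eqP; rewrite eqn_leq; apply/andP; split.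
  rewrite leqNgt; apply/negP => /(before_find 0).
  by rewrite nth_iota // add0n pd.
rewrite leqNgt; apply/negP => /minp /negP; apply.
have := nth_find 0 hs; rewrite nth_iota ?add0n //.
by rewrite has_find size_iota in hs.
Qed.

Lemma has_path0 (G : sgraph) (x y : G) : has_path x y 0 = (x == y).
Proof.
apply/existsP/idP => [[p]|/eqP <-]; first by rewrite (tuple0 p) /= andbT.
by exists [tuple]; rewrite /= eqxx.
Qed.

Lemma has_path1 (G : sgraph) (x y : G) : has_path x y 1 = adj x y.
Proof.
apply/existsP/idP => [[p]|xy].
  by case/tupleP: p => z p; rewrite (tuple0 p) /= => /and3P[+ /eqP <-];
    rewrite andbT.
exists [tuple y]; rewrite /= xy eqxx mem_seq1 /= andbT.
by apply: contraTneq xy => ->; rewrite adj_irrefl.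
Qed.

Lemma adj_rook (n : nat) (a b c d : 'I_n) :
  adj ((a, b) : rook n) (c, d) = (a == c) && (b != d) || (a != c) && (b == d).
Proof. by []. Qed.

(** Each edge changes exactly one coordinate; if both differ, the path through [(a, d)] has length
    2. *)
Lemma gdist_rook (n : nat) (x y : rook n) :
  2 < n -> gdist x y = (x.1 != y.1) + (x.2 != y.2).
Proof.
move=> hn; have cG : 2 < #|rook n| by rewrite card_prod !card_ord; nia.
case: x y => [a b] [c d] /=.
apply: gdist_eq.
- by apply: leq_ltn_trans cG; case: (a != c); case: (b != d).
- case: (eqVneq a c) => [->|ac]; case: (eqVneq b d) => [->|bd] /=.
  + by rewrite has_path0.
  + by rewrite has_path1 adj_rook eqxx bd.
  + by rewrite has_path1 adj_rook eqxx ac orbT.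
  + apply/existsP; exists [tuple ((a, d) : rook n); ((c, d) : rook n)].
    apply/and3P; split=> //.
      apply/and3P; split=> //; first by rewrite adj_rook eqxx bd.
      by rewrite adj_rook eqxx ac orbT.
    by rewrite /= !inE !xpair_eqE (negPf ac) (negPf bd) !andbF.
- case: (eqVneq a c) => [->|ac]; case: (eqVneq b d) => [->|bd] //= [|[|]] // _.
  + by rewrite has_path0 xpair_eqE (negPf bd) andbF.
  + by rewrite has_path0 xpair_eqE (negPf ac).
  + by rewrite has_path0 xpair_eqE (negPf ac).
  + by rewrite has_path1 adj_rook (negPf ac) (negPf bd) andbF.
Qed.

(** * Row and column counts, and the resolving criterion *)

Definition row (n : nat) (S : {set rook n}) : 'I_n -> nat :=
  fiber (fun w : rook n => w.1) S.
Definition col (n : nat) (S : {set rook n}) : 'I_n -> nat :=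
  fiber (fun w : rook n => w.2) S.

Lemma sum_mem_eq (T : finType) (S : {set T}) (u : T) :
  \sum_(w in S) (w == u) = (u \in S).
Proof.
case: (boolP (u \in S)) => uS.
  rewrite (bigD1 u) //= eqxx big1 // => w /andP[_ /negPf ->] //.
by rewrite big1 // => w wS; case: eqP => // wu; rewrite -wu wS in uS.
Qed.

Lemma sum_Delta_row (n : nat) (S : {set rook n}) (a b d : 'I_n) :
  2 < n -> b != d ->
  \sum_(w in S) Delta w ((a, b) : rook n) (a, d) = col S b + col S d.
Proof.
move=> hn bd; rewrite /col /fiber -big_split; apply: eq_bigr => -[i j] _ /=.
rewrite /Delta !gdist_rook //= ![j == _]eq_sym.
case: (a == i); have := bd;
  case: (eqVneq b j) => [e|_]; rewrite ?{}e;
  case: (eqVneq d j) => [e|_]; rewrite ?{}e;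
  rewrite ?eqxx //=; lia.
Qed.

Lemma sum_Delta_col (n : nat) (S : {set rook n}) (a c b : 'I_n) :
  2 < n -> a != c ->
  \sum_(w in S) Delta w ((a, b) : rook n) (c, b) = row S a + row S c.
Proof.
move=> hn ac; rewrite /row /fiber -big_split; apply: eq_bigr => -[i j] _ /=.
rewrite /Delta !gdist_rook //= ![i == _]eq_sym.
case: (b == j); have := ac;
  case: (eqVneq a i) => [e|_]; rewrite ?{}e;
  case: (eqVneq c i) => [e|_]; rewrite ?{}e;
  rewrite ?eqxx //=; lia.
Qed.

(** A vertex contributes one for each of the four lines through it, except [(a, d)] and [(c, b)]:
    these lie on two lines but are equidistant from both ends. The correction stands on the left to
    avoid truncated subtraction. *)
Lemma sum_Delta_diag (n : nat) (S : {set rook n}) (a b c d : 'I_n) :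
  2 < n -> a != c -> b != d ->
  \sum_(w in S) Delta w ((a, b) : rook n) (c, d)
    + (((a, d) : rook n) \in S).*2 + (((c, b) : rook n) \in S).*2
  = row S a + row S c + col S b + col S d.
Proof.
move=> hn ac bd; rewrite -!sum_mem_eq -!muln2 !big_distrl /row /col /fiber.
rewrite -!big_split; apply: eq_bigr => -[i j] _ /=.
rewrite /Delta !gdist_rook //= !xpair_eqE ![i == _]eq_sym ![j == _]eq_sym.
have := ac; have := bd.
case: (eqVneq a i) => [e|_]; rewrite ?{}e;
  case: (eqVneq c i) => [e|_]; rewrite ?{}e;
  case: (eqVneq b j) => [e|_]; rewrite ?{}e;
  case: (eqVneq d j) => [e|_]; rewrite ?{}e ?eqxx //=; lia.
Qed.

Lemma rook_resolvingP (n k : nat) (S : {set rook n}) : 2 < n ->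
  weak_resolving k S <->
  [/\ forall a c, a != c -> k <= row S a + row S c,
      forall b d, b != d -> k <= col S b + col S d &
      forall a b c d, a != c -> b != d ->
        k + (((a, d) : rook n) \in S).*2 + (((c, b) : rook n) \in S).*2
          <= row S a + row S c + col S b + col S d].
Proof.
move=> hn; pose o : 'I_n := Ordinal (ltnW (ltnW hn)).
split=> [res | [hr hc hd]].
  split=> [a c ac|b d bd|a b c d ac bd].
  - by rewrite -(sum_Delta_col S o) // res // xpair_eqE (negPf ac).
  - by rewrite -(sum_Delta_row S o) // res // xpair_eqE (negPf bd) andbF.
  - by rewrite -sum_Delta_diag // !leq_add2r res // xpair_eqE (negPf ac).
move=> [a b] [c d]; rewrite xpair_eqE.
case: (eqVneq a c) => [->|ac]; case: (eqVneq b d) => [->|bd] // _.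
- by rewrite sum_Delta_row // hc.
- by rewrite sum_Delta_col // hr.
- by have := hd _ _ _ _ ac bd; rewrite -sum_Delta_diag // !leq_add2r.
Qed.

Lemma sum_row (n : nat) (S : {set rook n}) : \sum_a row S a = #|S|.
Proof. exact: sum_fiber. Qed.

Lemma sum_col (n : nat) (S : {set rook n}) : \sum_b col S b = #|S|.
Proof. exact: sum_fiber. Qed.

Lemma row_gt0P (n : nat) (S : {set rook n}) (a : 'I_n) :
  reflect (exists d, ((a, d) : rook n) \in S) (0 < row S a).
Proof.
apply: (iffP (fiber_gt0P _ _ _)) => [[[i j] ? /= <-]|[d ?]]; first by exists j.
by exists (a, d).
Qed.

Lemma col_gt0P (n : nat) (S : {set rook n}) (b : 'I_n) :
  reflect (exists c, ((c, b) : rook n) \in S) (0 < col S b).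
Proof.
apply: (iffP (fiber_gt0P _ _ _)) => [[[i j] ? /= <-]|[d ?]]; first by exists i.
by exists (d, b).
Qed.

Lemma row_gt1 (n : nat) (S : {set rook n}) (a b d : 'I_n) :
  ((a, b) : rook n) \in S -> ((a, d) : rook n) \in S -> b != d -> 1 < row S a.
Proof.
move=> ub ud bd; apply: (fiber_gt1 (p := fun w : rook n => w.1) ub ud) => //.
by rewrite xpair_eqE (negPf bd) andbF.
Qed.

Lemma col_gt1 (n : nat) (S : {set rook n}) (a c b : 'I_n) :
  ((a, b) : rook n) \in S -> ((c, b) : rook n) \in S -> a != c -> 1 < col S b.
Proof.
move=> ua uc ac; apply: (fiber_gt1 (p := fun w : rook n => w.2) ua uc) => //.
by rewrite xpair_eqE (negPf ac).
Qed.

Lemma ord_neq (n : nat) (a : 'I_n) : 1 < n -> exists c : 'I_n, c != a.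
Proof.
move=> hn; have /card_gt0P[c] : 0 < #|predC1 a| by rewrite cardC1 card_ord; lia.
by exists c.
Qed.

(** * Lower bounds *)

Lemma resolving_card_ge (n k : nat) (S : {set rook n}) :
  2 < n -> weak_resolving k S -> n * uphalf k <= #|S| + odd k.
Proof.
move=> hn /(rook_resolvingP _ _ hn)[hr _ _].
have := sum_pair_ge (f := row S) (k := k); rewrite card_ord sum_row.
by apply => //; apply: ltnW.
Qed.

Lemma resolving3_card_ge (n : nat) (S : {set rook n}) :
  2 < n -> weak_resolving 3 S -> 2 * n <= #|S|.
Proof.
move=> hn /(rook_resolvingP _ _ hn)[hr hc hd]; rewrite leqNgt; apply/negP => lt.
have [] := @sum_pair3_extremal _ (row S); rewrite ?card_ord ?sum_row //.
move=> a ra rle.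
have [] := @sum_pair3_extremal _ (col S); rewrite ?card_ord ?sum_col //.
move=> b cb cle.
have r0 c : 0 < row S c.
  have [->|ca] := eqVneq c a; last by have := hr _ _ ca; lia.
  have [e ea] := ord_neq a (ltnW hn).
  by have := hr _ _ ea; have := rle _ ea; lia.
have c0 c : 0 < col S c.
  have [->|ca] := eqVneq c b; last by have := hc _ _ ca; lia.
  have [e eb] := ord_neq b (ltnW hn).
  by have := hc _ _ eb; have := cle _ eb; lia.
(* Both cases yield two opposite corners in [S], on row [a], column [b] and one more row and column.
   The third condition then requires 7, but the four counts add up to at most 1 + 1 + 2 + 2. *)
have [abS|abS] := boolP (((a, b) : rook n) \in S).
  have [c ca] := ord_neq a (ltnW hn).
  have /row_gt0P[e ceS] := r0 c.
  have eb : e != b.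
    apply: contraTneq cb => eb; rewrite -ltnNge.
    by rewrite eb in ceS; exact: col_gt1 ceS abS ca.
  have := hd a e c b; rewrite abS ceS (eq_sym a) => /(_ ca eb).
  by have := rle _ ca; have := cle _ eb; lia.
have /row_gt0P[d adS] := r0 a.
have /col_gt0P[c cbS] := c0 b.
have ac : a != c by apply: contraNneq abS => ->.
have bd : b != d by apply: contraNneq abS => ->.
have := hd a b c d ac bd; rewrite adS cbS.
rewrite eq_sym in ac; rewrite eq_sym in bd.
by have := rle _ ac; have := cle _ bd; lia.
Qed.

Lemma resolving2_card_ge (n : nat) (S : {set rook n}) :
  2 < n -> weak_resolving 2 S -> 4 * n <= 3 * #|S|.
Proof.
move=> hn /(rook_resolvingP _ _ hn)[hr hc hd].
(* An empty line forces 2 on each other parallel line, and [6 (n - 1) >= 4 n]. *)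
have big0 (f : 'I_n -> nat) a : (forall a c, a != c -> 2 <= f a + f c) ->
    f a = 0 -> 4 * n <= 3 * \sum_i f i.
  move=> H fa; have /sum_ge_but_one : forall c, c != a -> 2 <= f c.
    by move=> c ca; have := H _ _ ca; lia.
  by rewrite card_ord; lia.
have [/forallP r0|/forallPn[a]] := boolP [forall a, 0 < row S a]; last first.
  by rewrite -eqn0Ngt -sum_row => /eqP/big0; apply.
have [/forallP c0|/forallPn[a]] := boolP [forall b, 0 < col S b]; last first.
  by rewrite -eqn0Ngt -sum_col => /eqP/big0; apply.
have nonattacking a b c d :
    ((a, b) : rook n) \in S -> ((c, d) : rook n) \in S ->
    a != c -> b != d -> 6 <= row S a + row S c + col S b + col S d.
  move=> abS cdS ac bd; have := hd a d c b ac.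
  by rewrite abS cdS eq_sym bd => /(_ isT); lia.
pose r1 := \sum_a (row S a == 1); pose c1 := \sum_b (col S b == 1).
have single_ge (f : 'I_n -> nat) : (forall a, 0 < f a) ->
    2 * n <= \sum_a f a + \sum_a (f a == 1).
  move=> f0; rewrite -big_split -{1}[n]card_ord mulnC -sum_nat_const.
  by apply: leq_sum => a _; have := f0 a; case: (f a) => [|[]].
have rS : 2 * n <= #|S| + r1 by rewrite -sum_row single_ge.
have cS : 2 * n <= #|S| + c1 by rewrite -sum_col single_ge.
have rc1 : r1 + c1 = \sum_(w in S) ((row S w.1 == 1) + (col S w.2 == 1)).
  rewrite big_split /=; congr (_ + _).
    rewrite (sum_fiber_weighted (fun w : rook n => w.1) S
      (fun a => row S a == 1)).
    apply: eq_bigr => a _; rewrite -/(row S a).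
    by case: eqP => [->|]; rewrite ?muln0.
  rewrite (sum_fiber_weighted (fun w : rook n => w.2) S
      (fun a => col S a == 1)).
  apply: eq_bigr => a _; rewrite -/(col S a).
  by case: eqP => [->|]; rewrite ?muln0.
(* A vertex alone in its row and in its column is counted twice in [r1 + c1].
   Two such vertices would violate [nonattacking]. *)
have [iso|noiso] := boolP [exists w : rook n,
    [&& w \in S, row S w.1 == 1 & col S w.2 == 1]]; last first.
  suff : r1 + c1 <= #|S| by lia.
  rewrite rc1 -sum1_card; apply: leq_sum => w wS.
  have /existsPn/(_ w) := noiso; rewrite wS /=.
  by case: (_ == 1); case: (_ == 1).
case/existsP: iso => -[a b] /and3P[abS /= /eqP ra /eqP cb].
have away c d : ((c, d) : rook n) \in S -> c != a ->
    d != b /\ 4 <= row S c + col S d.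
  move=> cdS ca; have db : d != b.
    apply/eqP => db; rewrite db in cdS.
    by have := col_gt1 cdS abS ca; rewrite cb.
  by split=> //; have := nonattacking _ _ _ _ cdS abS ca db; lia.
have rc1S : r1 + c1 <= #|S| + 1.
  have -> : #|S| + 1 = \sum_(w in S) (1 + (w == ((a, b) : rook n))).
    by rewrite big_split sum_mem_eq abS sum1_card.
  rewrite rc1; apply: leq_sum => -[c d] cdS /=; rewrite xpair_eqE.
  have [ca|ca] := eqVneq c a.
    rewrite ca ra in cdS *; have [->|db] := eqVneq d b; first by rewrite cb.
    by have := row_gt1 cdS abS db; rewrite ra.
  have [_] := away _ _ cdS ca.
  by case: (row S c) (col S d) => [|[|?]] [|[|?]].
(* The doubly counted vertex costs 1 in [rc1S]. A second row of size 1 regains it: its vertex lies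
   in a column of size at least 3, which improves [cS] by 1. *)
have [/existsP[c /andP[ca /eqP rc]]|only] :=
  boolP [exists c, (c != a) && (row S c == 1)].
  have /row_gt0P[d cdS] := r0 c.
  have [db cd] := away _ _ cdS ca.
  suff : 2 * n + 1 <= #|S| + c1.
    by move: rS rc1S; move: #|S| (r1) (c1) => *; lia.
  have -> : 2 * n + 1 = \sum_(e < n) (2 + (e == d)).
    by rewrite big_split sum_pred1 sum_nat_const card_ord mulnC.
  rewrite -sum_col -big_split; apply: leq_sum => e _ /=.
  have [->|ed] := eqVneq e d.
    by move: cd; rewrite rc; case: (col S d) => [|[|[|?]]].
  by have := c0 e; case: (col S e) => [|[]].
(* With a single row of size 1, [#|S| >= 2 n - 1] is already enough. *)
suff : r1 <= 1 by move: rS; move: #|S| (r1) => *; lia.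
rewrite -(sum_pred1 a); apply: leq_sum => c _.
by have /existsPn/(_ c) := only; case: (c == a) => //=; case: (row S c == 1).
Qed.

(** * Constructions *)

Lemma card_ord_lt (n m : nat) : m <= n -> #|[set t : 'I_n | t < m]| = m.
Proof.
move=> mn; rewrite -[RHS]card_ord -!sum1_card (big_ord_widen n (fun=> 1) mn).
by apply: eq_bigl => t; rewrite inE.
Qed.

(** A cyclic band of width [m]: with arithmetic modulo the grid size, row [a] holds the columns
    [a + t] and column [b] the rows [b - t], for [t < m]. *)
Lemma exists_regular (n m : nat) : 0 < n -> m <= n ->
  exists S : {set rook n}, (forall a, row S a = m) /\ (forall b, col S b = m).
Proof.
case: n => // n _ mn.
exists [set w : rook n.+1 | (w.2 - w.1 : 'I_n.+1)%R < m]; split=> [a|b].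
  rewrite /row fiber_card -[RHS](card_ord_lt mn).
  rewrite -[RHS](card_imset _
    (f := fun t : 'I_n.+1 => ((a, a + t)%R : rook n.+1))); last first.
    by move=> s t /eqP; rewrite xpair_eqE eqxx => /eqP /GRing.addrI.
  apply: eq_card => -[i j]; rewrite !inE [_.1]/= [_.2]/=.
  apply/andP/imsetP => [[lt /eqP e]|[t]].
    exists (j - i)%R; rewrite ?inE // -e; congr pair.
    by rewrite GRing.addrC GRing.subrK.
  rewrite inE => lt /eqP; rewrite xpair_eqE => /andP[/eqP -> /eqP ->].
  by rewrite eqxx [(a + t)%R]GRing.addrC GRing.addrK.
rewrite /col fiber_card -[RHS](card_ord_lt mn).
rewrite -[RHS](card_imset _
  (f := fun t : 'I_n.+1 => ((b - t, b)%R : rook n.+1))); last first.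
  move=> s t /eqP; rewrite xpair_eqE eqxx andbT.
  by move=> /eqP /GRing.addrI /GRing.oppr_inj.
apply: eq_card => -[i j]; rewrite !inE [_.1]/= [_.2]/=.
apply/andP/imsetP => [[lt /eqP e]|[t]].
  exists (j - i)%R; rewrite ?inE // -e; congr pair.
  by rewrite GRing.opprB GRing.addrC GRing.subrK.
rewrite inE => lt /eqP; rewrite xpair_eqE => /andP[/eqP -> /eqP ->].
by rewrite eqxx GRing.opprB GRing.addrC GRing.subrK.
Qed.

Lemma card_regular (n m : nat) (S : {set rook n}) :
  (forall a, row S a = m) -> #|S| = n * m.
Proof.
move=> rS; rewrite -sum_row (eq_bigr (fun=> m)) => [|a _]; last exact: rS.
by rewrite sum_nat_const card_ord.
Qed.

(** For a regular set of degree [m = uphalf k], the third condition asks at worst [k + 4 <= 4 m],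
    which holds from [k = 3] on. *)
Lemma exists_resolving (n k : nat) : 2 < n -> 2 < k <= 2 * n ->
  exists2 S : {set rook n}, weak_resolving k S & #|S| = n * uphalf k.
Proof.
move=> hn hk; have [||S [rS cS]] := @exists_regular n (uphalf k); try lia.
exists S; last exact: card_regular.
by apply/rook_resolvingP => //; split=> *; rewrite ?rS ?cS; lia.
Qed.

(** Deleting a vertex lowers one row and one column by 1, and [2 * uphalf k - 1 = k] for odd [k].
    The third condition follows from the other two, as [k + 4 <= 2 k]. *)
Lemma exists_resolving_odd (n k : nat) : 2 < n -> 3 < k <= 2 * n -> odd k ->
  exists2 S : {set rook n}, weak_resolving k S & #|S| = n * uphalf k - 1.
Proof.
move=> hn hk ok; have [||S [rS cS]] := @exists_regular n (uphalf k); try lia.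
have cardS := card_regular rS.
have /card_gt0P[u uS] : 0 < #|S| by rewrite cardS muln_gt0; lia.
exists (S :\ u); last by rewrite -cardS (cardsD1 u S) uS addKn.
have hr a c : a != c -> k <= row (S :\ u) a + row (S :\ u) c.
  move=> ac.
  have := fiber_setD1 (fun w : rook n => w.1) S u a.
  have := fiber_setD1 (fun w : rook n => w.1) S u c.
  rewrite -!/(row _ _) !rS; have := ac.
  by case: (eqVneq u.1 a) => [->|_]; case: eqP => //= *; lia.
have hc a c : a != c -> k <= col (S :\ u) a + col (S :\ u) c.
  move=> ac.
  have := fiber_setD1 (fun w : rook n => w.2) S u a.
  have := fiber_setD1 (fun w : rook n => w.2) S u c.
  rewrite -!/(col _ _) !cS; have := ac.
  by case: (eqVneq u.2 a) => [->|_]; case: eqP => //= *; lia.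
apply/rook_resolvingP => //; split=> // a b c d ac bd.
by have := hr _ _ ac; have := hc _ _ bd; do 2 case: (_ \in _); lia.
Qed.

(** A full block on indices [3q], [3q+1], [3q+2] has two vertices in row [3q] and two in column
    [3q+2]. An upper bound on the size suffices, since the lower bound turns it into equality. *)
Lemma exists_resolving2 (n : nat) : 2 < n ->
  exists2 S : {set rook n}, weak_resolving 2 S & #|S| <= ceil_div (4 * n) 3.
Proof.
case: n => // n hn.
(* Row [i] contains [(i, f i)], and also [(i, g i)] when 3 divides [i]: every
   row and column is nonempty, and no vertex is alone in both its row and its
   column.  The minimum in [f] and the value 0 in [g] only serve the incomplete
   last block. *)
pose cell x y : rook n.+1 := (inord x, inord y).
pose f i := if i %% 3 == 1 then minn i.+1 n else i.
pose g i := if i < n then i.+1 else 0.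
pose S1 := [set cell i (f i) | i : 'I_n.+1].
pose S2 := [set cell (3 * q) (g (3 * q)) | q : 'I_(ceil_div n.+1 3)].
have neq x y : x < n.+1 -> y < n.+1 -> x != y -> inord x != inord y :> 'I_n.+1.
  move=> xn yn; apply: contraNneq => /(congr1 val).
  by rewrite /= !inordK // => ->.
have inf x y : x < n.+1 -> y = f x -> cell x y \in S1 :|: S2.
  move=> xn ->; rewrite inE; apply/orP; left.
  by apply/imsetP; exists (Ordinal xn).
have ing x y : x < n.+1 -> x %% 3 = 0 -> y = g x -> cell x y \in S1 :|: S2.
  move=> xn x3 ->; rewrite inE; apply/orP; right.
  have qn : x %/ 3 < ceil_div n.+1 3 by rewrite /ceil_div /=; lia.
  apply/imsetP; exists (Ordinal qn) => //=.
  by have -> : 3 * (x %/ 3) = x by lia.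
exists (S1 :|: S2); last first.
  apply: leq_trans (leq_card_setU _ _) _.
  apply: leq_trans (leq_add (leq_imset_card _ _) (leq_imset_card _ _)) _.
  by rewrite !card_ord /ceil_div /=; lia.
set S := S1 :|: S2 in inf ing *.
have r0 (a : 'I_n.+1) : 0 < row S a.
  by apply/row_gt0P; exists (inord (f a)); rewrite -{1}[a]inord_val; apply: inf.
have c0 (b : 'I_n.+1) : 0 < col S b.
  apply/col_gt0P; have bn := ltn_ord b.
  have [b1|b1] := eqVneq (b %% 3) 1.
    exists (inord b.-1); rewrite -[b in (_, b)]inord_val.
    apply: ing; rewrite /g; try lia.
    by case: ifP; lia.
  exists (inord b); rewrite -[b in (_, b)]inord_val.
  by apply: inf; rewrite /f ?(negPf b1).
have v3 (a b : 'I_n.+1) : ((a, b) : rook n.+1) \in S -> 3 <= row S a + col S b.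
  move=> abS.
  have an := ltn_ord a; have bn := ltn_ord b.
  have [a0|a0] := eqVneq (a %% 3) 0.
    suff : 1 < row S a by have := c0 b; lia.
    rewrite -[a]inord_val; apply: (row_gt1 (b := inord a) (d := inord (g a))).
    - by apply: inf; rewrite /f // a0.
    - exact: ing.
    - by apply: neq; rewrite /g //; case: ifP; lia.
  suff : 1 < col S b by have := r0 a; lia.
  (* A row not divisible by 3 meets [S] only in column [f a], which a neighbouring row also
     meets. *)
  have bE : b = f a :> nat.
    move: abS; rewrite inE => /orP[] /imsetP[i _] [].
      move=> -> ->; rewrite inord_val inordK // /f.
      by case: ifP; have := ltn_ord i; lia.
    move=> /(congr1 val) /=; rewrite inordK; last first.
      by have := ltn_ord i; rewrite /ceil_div /=; lia.
    by move=> ai; move: a0; rewrite ai; lia.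
  have [a1|a1] := eqVneq (a %% 3) 1; rewrite /f ?a1 ?(negPf a1) /= in bE.
    have [alt|age] := ltnP a n.
      rewrite -[b]inord_val; apply: (col_gt1 (a := inord a) (c := inord a.+1)).
      + by apply: inf; rewrite /f ?a1.
      + by apply: inf; rewrite /f; [lia|case: ifP; lia].
      + by apply: neq; lia.
    rewrite -[b]inord_val; apply: (col_gt1 (a := inord a) (c := inord a.-1)).
    + by apply: inf; rewrite /f ?a1.
    + by apply: ing; rewrite /g; [lia|lia|case: ifP; lia].
    + by apply: neq; lia.
  rewrite -[b]inord_val; apply: (col_gt1 (a := inord a) (c := inord a.-1)).
  + by apply: inf; rewrite /f ?(negPf a1).
  + by apply: inf; rewrite /f; [lia|case: ifP; lia].
  + by apply: neq; lia.
apply/rook_resolvingP => //; split=> [a c _|b d _|a b c d _ _].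
- by have := r0 a; have := r0 c; lia.
- by have := c0 b; have := c0 d; lia.
(* Each corner in [S] raises the bound on its row plus column from 2 to 3; this gives 4, 5 or 6 in
   total against the required 2, 4 or 6. *)
have := r0 a; have := r0 c; have := c0 b; have := c0 d.
have := v3 a d; have := v3 c b.
by case: (_ \in S) => [/(_ isT) ?|_]; case: (_ \in S) => [/(_ isT) ?|_]; lia.
Qed.

(** * The weak dimension in all cases *)

Theorem theorem1p1 (n k : nat) (hn : 3 <= n) (hk : 2 <= k <= 2 * n) :
  is_wdim (cart_graph (complete_graph n) (complete_graph n)) k
    (if k == 2 then ceil_div (4 * n) 3
     else if (k == 3) || (4 <= k) && ~~ odd k then n * ceil_div k 2
     else n * ceil_div k 2 - 1).
Proof.
have -> : ceil_div k 2 = uphalf k by rewrite /ceil_div /=; lia.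
have [->|k2] := eqVneq k 2.
  have lower (S : {set rook n}) :
      weak_resolving 2 S -> ceil_div (4 * n) 3 <= #|S|.
    by move=> resS; rewrite ceil_divP // [leqRHS]mulnC resolving2_card_ge.
  split=> //; have [S resS cardS] := exists_resolving2 hn.
  by exists S => //; apply/eqP; rewrite eqn_leq cardS lower.
have k_gt2 : 2 < k by lia.
case: ifP => [/orP ek|nek].
  split; first by apply: exists_resolving => //; lia.
  move=> S resS; case: ek => [/eqP k3|/andP[_ evk]].
    by rewrite k3 mulnC resolving3_card_ge // -k3.
  by have := resolving_card_ge hn resS; rewrite (negPf evk) addn0.
have [ok k_gt3] : odd k /\ 3 < k by move: nek; case: (odd k); lia.
split; first by apply: exists_resolving_odd => //; lia.
by move=> S resS; have := resolving_card_ge hn resS; rewrite ok leq_subLR addnC.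
Qed.
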